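(* Fix integers $K\ge2$ and $\theta\in(0,1)$. Essentially universally optimal mechanisms for histogram sanitization with respect to $\mathbb{L}_1$-distortion exist: there exist a set $\mathcal{H}^n_{\mathrm{ext}}$ and, for each $n$, a $\theta$-DP mechanism $\mathbb{U}^n:\mathcal{H}^n\Rightarrow\mathcal{H}^n_{\mathrm{ext}}$ not depending on $\underline p$, such that for every probability vector $\underline p$ on $K$ elements with all entries positive there are mechanisms $\mathbb{V}^n:\mathcal{H}^n_{\mathrm{ext}}\Rightarrow\mathcal{H}^n$ for which the cascades $\mathbb{W}^n(\underline g|\underline h)=\sum_{\underline b\in\mathcal{H}^n_{\mathrm{ext}}}\mathbb{U}^n(\underline b|\underline h)\mathbb{V}^n(\underline g|\underline b)$ are $\theta$-DP HSMs satisfying $\lim_{n\to\infty}D^n(\mathbb{W}^n,\underline p)=D_K^*(\theta,\underline p)$.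
   Context: Let $\mathcal{H}^n=\{(h_1,\dots,h_K)\in\mathbb{Z}^K: h_k\ge0,\ \sum_k h_k=n\}$; $\underline h,\underline{\hat h}\in\mathcal{H}^n$ are neighboring if $|\underline h-\underline{\hat h}|_1=2$. A mechanism $\mathbb{M}:\mathcal{H}^n\Rightarrow\mathcal{B}$ assigns to each $\underline h\in\mathcal{H}^n$ a pmf $\mathbb{M}(\cdot|\underline h)$ on the set $\mathcal{B}$; it is $\theta$-DP if $\theta\mathbb{M}(b|\underline h)\le\mathbb{M}(b|\underline{\hat h})\le\theta^{-1}\mathbb{M}(b|\underline h)$ for all neighboring $\underline h,\underline{\hat h}$ and all $b\in\mathcal{B}$. A histogram sanitizing mechanism (HSM) is a mechanism $\mathcal{H}^n\Rightarrow\mathcal{H}^n$. Define $D^n(\mathbb{W},\underline p)=\sum_{\underline h,\underline g\in\mathcal{H}^n}\binom{n}{h_1,\dots,h_K}\prod_k p_k^{h_k}\mathbb{W}(\underline g|\underline h)|\underline h-\underline g|_1$, $D^n_*(\theta,\underline p)=\min D^n(\mathbb{W},\underline p)$ over $\theta$-DP HSMs, and $D_K^*(\theta,\underline p)=\lim_{n\to\infty}D^n_*(\theta,\underline p)$. A sequence of $\theta$-DP HSMs $\mathbb{W}^n$ is called essentially universally optimal if each $\mathbb{W}^n$ is a cascade of $\mathbb{U}^n:\mathcal{H}^n\Rightarrow\mathcal{H}^n_{\mathrm{ext}}$ and $\mathbb{V}^n:\mathcal{H}^n_{\mathrm{ext}}\Rightarrow\mathcal{H}^n$ (for some, not necessarily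 finite, set $\mathcal{H}^n_{\mathrm{ext}}$) with $\mathbb{U}^n$ $\theta$-DP and invariant with $\underline p$ (only $\mathbb{V}^n$ may depend on $\underline p$), and $\lim_n D^n(\mathbb{W}^n,\underline p)=D_K^*(\theta,\underline p)$ for every pmf $\underline p$ (with positive entries) on $K$ elements. *)

(* Defs.v *)
From HB Require Import structures.
From mathcomp Require Import all_boot all_order all_algebra.
From mathcomp Require Import all_classical all_reals all_analysis.
Set Implicit Arguments. Unset Strict Implicit. Unset Printing Implicit Defensive.
Import Order.TTheory GRing.Theory Num.Theory.
Import numFieldNormedType.Exports.
Local Open Scope ring_scope.
Local Open Scope classical_set_scope.

Definition hist (K n : nat) : finType :=
  {h : {ffun 'I_K -> 'I_n.+1} | (\sum_(k < K) (h k : nat))%N == n}.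

Definition histv K n (h : hist K n) (k : 'I_K) : nat := (val h k : nat).

Section Defs.
Variable R : realType.

Definition l1dist K n (h g : hist K n) : R :=
  \sum_(k < K) `|(histv h k)%:R - (histv g k)%:R|.

Definition neighboring K n (h g : hist K n) : Prop := l1dist h g = 2.

(* A mechanism H^n => B is M : B -> hist -> R, M b h = M(b|h).
   pmf on an arbitrary (choice) type B: nonnegative, summing to 1. *)
Definition is_mechanism K n (B : choiceType) (M : B -> hist K n -> R) : Prop :=
  forall h, (forall b, 0 <= M b h) /\ (\esum_(b in [set: B]) (M b h)%:E = 1)%E.

Definition is_DP K n (B : Type) (theta : R) (M : B -> hist K n -> R) : Prop :=
  forall h h', neighboring h h' -> forall b,
    theta * M b h <= M b h' /\ M b h' <= theta^-1 * M b h.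

Definition is_HSM K n (W : hist K n -> hist K n -> R) : Prop :=
  forall h, (forall g, 0 <= W g h) /\ \sum_(g : hist K n) W g h = 1.

Definition is_mech_to_hist K n (B : Type) (V : hist K n -> B -> R) : Prop :=
  forall b, (forall g, 0 <= V g b) /\ \sum_(g : hist K n) V g b = 1.

Definition multinom K n (h : hist K n) : R :=
  (n`!)%:R / \prod_(k < K) ((histv h k)`!)%:R.

Definition Dn K n (W : hist K n -> hist K n -> R) (p : 'I_K -> R) : R :=
  \sum_(h : hist K n) \sum_(g : hist K n)
    multinom h * (\prod_(k < K) p k ^+ histv h k) * W g h * l1dist h g.

(* D^n_*(theta, p) = min over theta-DP HSMs (written as inf; the min is attained) *)
Definition Dn_star K n (theta : R) (p : 'I_K -> R) : R :=
  inf [set Dn W p | W in [set W : hist K n -> hist K n -> R |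
                             is_HSM W /\ is_DP theta W]].

Definition DK_star K (theta : R) (p : 'I_K -> R) : R :=
  limn (fun n => Dn_star n theta p).

Definition cascade K n (B : choiceType) (U : B -> hist K n -> R)
  (V : hist K n -> B -> R) : hist K n -> hist K n -> R :=
  fun g h => fine (\esum_(b in [set: B]) (U b h * V g b)%:E).

End Defs.

(* Main.v *)
Require Import Defs.
From HB Require Import structures.
From mathcomp Require Import all_boot all_order all_algebra.
From mathcomp Require Import finmap.
From mathcomp Require Import all_classical all_reals all_analysis.
From mathcomp Require Import zify ring lra.
Import Order.TTheory GRing.Theory Num.Theory.
Import numFieldNormedType.Exports.
Set Implicit Arguments. Unset Strict Implicit. Unset Printing Implicit Defensive.
Local Open Scope ring_scope.
Local Open Scope classical_set_scope.

(* Let [lattice K] be Z^K.  A translation-invariant mechanism [U(b | h) = f (b - h)]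
   is theta-DP as soon as the pmf [f] on the sum-zero sublattice satisfies
   [theta * f x <= f (x + v)] for all [v] with [|v|_1 = 2].  Let [D] be the least
   mean l1 norm of such an [f]; a compactness argument (pointwise limits along an
   ultrafilter, with tightness supplied by the bounded mean norm) shows that [D]
   is attained.  The optimal [f] does not depend on [p], and [U] followed by
   projection to the nearest histogram has distortion at most [D + o(1)], because a
   fixed translate of a multinomial histogram leaves [H^n] with vanishing
   probability.  Conversely, averaging an arbitrary theta-DP HSM against the
   multinomial law yields the pmf of the displacement [g - h], whose mean norm is
   [D^n]; the multinomial law being asymptotically invariant under sum-zero shifts,
   this pmf satisfies the constraint up to [o(1)], and compactness gives
   [liminf D^n_* >= D]. *)

(** * The lattice and the multinomial law *)

Notation lattice K := {ffun 'I_K -> int}.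

Section Lattice.
Variable K : nat.
Implicit Types x y z : lattice K.

Definition l1norm x : nat := (\sum_(k < K) `|x k|)%N.

Definition coord_sum x : int := \sum_(k < K) x k.

Definition unit_vec (i : 'I_K) : lattice K := [ffun k => (k == i)%:R].

Lemma l1norm_triangle x y : (l1norm (x + y)%R <= l1norm x + l1norm y)%N.
Proof.
rewrite /l1norm -big_split /=; apply: leq_sum => k _.
by rewrite ffunE; move: (x k) (y k) => a b; lia.
Qed.

Lemma l1normN x : l1norm (- x) = l1norm x.
Proof. by apply: eq_bigr => k _; rewrite ffunE abszN. Qed.

Lemma l1norm_eq0 x : l1norm x = 0%N -> x = 0.
Proof.
move=> /eqP; rewrite sum_nat_eq0 => /forallP x0.
by apply/ffunP => k; rewrite ffunE; apply/eqP; rewrite -absz_eq0; apply: x0.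
Qed.

Lemma coord_sumD x y : coord_sum (x + y) = coord_sum x + coord_sum y.
Proof. by rewrite /coord_sum -big_split /=; apply: eq_bigr => k _; rewrite ffunE. Qed.

Lemma coord_sumN x : coord_sum (- x) = - coord_sum x.
Proof. by rewrite /coord_sum -sumrN; apply: eq_bigr => k _; rewrite ffunE. Qed.

Lemma coord_sum_unit i : coord_sum (unit_vec i) = 1.
Proof.
rewrite /coord_sum (bigD1 i) //= ffunE eqxx big1 ?addr0 // => k /negbTE ki.
by rewrite ffunE ki.
Qed.

(** The copies of [unit_vec i] carry total coefficient [coord_sum x], so they cancel. This reduces
    shift-invariance along sum-zero vectors to moving one sample from one class to another. *)
Lemma sum_zero_decomposition i x : coord_sum x = 0 ->
  x = \sum_(k < K) (unit_vec k - unit_vec i) *~ x k.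
Proof.
move=> x0; under eq_bigr do rewrite mulrzBl.
rewrite sumrB -mulrz_sumr; move: x0; rewrite /coord_sum => ->; rewrite mulr0z subr0.
have zE (y : lattice K) (m : int) k : (y *~ m) k = y k * m.
  rewrite -mulrzz; case: m => m; rewrite ?NegzE ?mulrNz -!pmulrn ?ffunE.
    by elim: m => [|m IH]; rewrite ?mulr0n ?ffunE // !mulrS ffunE IH.
  congr (- _); elim: m.+1 => [|m' IH]; rewrite ?mulr0n ?ffunE // !mulrS ffunE IH //.
apply/ffunP => j; rewrite sum_ffunE (bigD1 j) //= big1 ?addr0.
  by rewrite zE ffunE eqxx mul1r.
by move=> k /negbTE kj; rewrite zE ffunE eq_sym kj mul0r.
Qed.

End Lattice.

(** * Histograms as nonnegative lattice points *)

Section Histograms.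
Variables (K n : nat).
Implicit Types (h g : hist K n) (z : lattice K).

Definition hist_lattice h : lattice K := [ffun k => (histv h k)%:Z].

Lemma hist_lattice_inj : injective hist_lattice.
Proof.
move=> h g /ffunP e; apply/val_inj/ffunP => k; apply/val_inj.
by have := e k; rewrite !ffunE => -[].
Qed.

Lemma sum_histv h : (\sum_(k < K) histv h k)%N = n.
Proof. exact/eqP/(valP h). Qed.

Lemma coord_sum_hist h : coord_sum (hist_lattice h) = n%:Z.
Proof.
rewrite /coord_sum; under eq_bigr do rewrite ffunE.
by rewrite -[in RHS](sum_histv h) -natz natr_sum; apply: eq_bigr => k _; rewrite natz.
Qed.

(** The bound [n] on each entry, built into the type [hist], follows from nonnegativity and the
    total. The result is a sigma type so that histograms can be defined from it. *)
Lemma hist_of_lattice z : (forall k, 0 <= z k) -> coord_sum z = n%:Z ->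
  {h | hist_lattice h = z}.
Proof.
move=> z0 zn.
have zs : (\sum_(k < K) `|z k|)%N = n.
  apply/eqP; rewrite -eqz_nat -zn /coord_sum -natz natr_sum; apply/eqP.
  by apply: eq_bigr => k _; rewrite natz gez0_abs.
have zb k : (`|z k| < n.+1)%N by rewrite ltnS -zs (bigD1 k) //= leq_addr.
have P : (\sum_(k < K) ([ffun k => Ordinal (zb k)] k : nat))%N == n.
  by rewrite -[X in _ == X]zs; apply/eqP; apply: eq_bigr => k _; rewrite ffunE.
exists (exist _ [ffun k => Ordinal (zb k)] P).
by apply/ffunP => k; rewrite !ffunE /histv /= ffunE /= gez0_abs.
Qed.

Definition in_hist z : bool := [exists h, hist_lattice h == z].

Lemma in_histP z : reflect (exists h, hist_lattice h = z) (in_hist z).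
Proof. exact: 'exists_eqP. Qed.

Lemma in_hist_lattice h : in_hist (hist_lattice h).
Proof. by apply/in_histP; exists h. Qed.

Lemma l1dist_l1norm (R : realType) h g :
  l1dist R h g = (l1norm (hist_lattice h - hist_lattice g))%:R.
Proof.
rewrite /l1dist /l1norm natr_sum; apply: eq_bigr => k _.
rewrite !ffunE -[_ - _]/(_ - _ : R) natr_absz intr_norm rmorphB /=.
by rewrite -!pmulrn.
Qed.

End Histograms.

Section AddUnit.
Variables (K n : nat) (i : 'I_K).

Lemma hist_add_unit_ex (h : hist K n) :
  {g : hist K n.+1 | hist_lattice g = hist_lattice h + unit_vec i}.
Proof.
apply: hist_of_lattice => [k|].
  by rewrite !ffunE; apply: addr_ge0.
by rewrite coord_sumD coord_sum_hist coord_sum_unit intS addrC.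
Qed.

Definition hist_add_unit h := sval (hist_add_unit_ex h).

Lemma hist_add_unitE h :
  hist_lattice (hist_add_unit h) = hist_lattice h + unit_vec i.
Proof. by rewrite /hist_add_unit; case: hist_add_unit_ex. Qed.

Lemma histv_add_unit h k : histv (hist_add_unit h) k = (histv h k + (k == i))%N.
Proof.
by have /ffunP/(_ k) := hist_add_unitE h; rewrite !ffunE natz -PoszD => -[].
Qed.

Lemma hist_add_unit_inj : injective hist_add_unit.
Proof.
move=> h g e; apply: hist_lattice_inj; apply: (@addIr _ (unit_vec i)).
by rewrite -!hist_add_unitE e.
Qed.

Lemma hist_add_unit_surj (g : hist K n.+1) : (0 < histv g i)%N ->
  exists h, g = hist_add_unit h.
Proof.
move=> g0.
have [||h hE] := @hist_of_lattice K n (hist_lattice g - unit_vec i).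
- by move=> k; rewrite !ffunE; case: eqP => [->|_]; lia.
- by rewrite coord_sumD coord_sumN coord_sum_hist coord_sum_unit; lia.
by exists h; apply: hist_lattice_inj; rewrite hist_add_unitE hE subrK.
Qed.

End AddUnit.

(** * Moments and near shift-invariance of the multinomial law *)

Section Multinomial.
Variables (R : realType) (K : nat) (p : 'I_K -> R).

Definition multinomial_pmf n (h : hist K n) : R :=
  multinom R h * \prod_(k < K) p k ^+ histv h k.

Definition multinomial_mean n (phi : lattice K -> R) : R :=
  \sum_(h : hist K n) multinomial_pmf h * phi (hist_lattice h).

Lemma multinomial_pmf_add_unit n i (h : hist K n) :
  (histv (hist_add_unit i h) i)%:R * multinomial_pmf (hist_add_unit i h) =
  n.+1%:R * p i * multinomial_pmf h.
Proof.
rewrite /multinomial_pmf /multinom.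
rewrite [X in _ / X * _](bigD1 i) //= [X in _ / _ * X](bigD1 i) //=.
rewrite [X in _ = _ * (_ / X * _)](bigD1 i) //= [X in _ = _ * (_ / _ * X)](bigD1 i) //=.
under [X in _ / (_ * X)]eq_bigr => k /negbTE ki do
  rewrite histv_add_unit ki addn0.
under [X in _ / _ * (_ * X)]eq_bigr => k /negbTE ki do
  rewrite histv_add_unit ki addn0.
set A := \prod_(_ | _) _; set B := \prod_(_ | _) _.
have A0 : A != 0.
  by apply/prodf_neq0 => k _; rewrite pnatr_eq0 -lt0n fact_gt0.
rewrite histv_add_unit eqxx addn1 !factS exprS !natrM.
have f0 : ((histv h i)`!%:R : R) != 0 by rewrite pnatr_eq0 -lt0n fact_gt0.
have s0 : ((histv h i).+1%:R : R) != 0 by rewrite pnatr_eq0.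
field; rewrite A0 f0 /=.
by have := ler0n R (histv h i); lra.
Qed.

(** Size-biasing: weighting by the [i]-th count kills the histograms without a sample in class [i],
    and the others are exactly the images of [hist_add_unit i]. All moments below come from this
    recursion. *)
Lemma multinomial_mean_coord n i phi :
  multinomial_mean n.+1 (fun z => (z i)%:~R * phi z) =
  n.+1%:R * p i * multinomial_mean n (fun z => phi (z + unit_vec i)).
Proof.
rewrite /multinomial_mean big_distrr /=.
rewrite [LHS](bigID [in [set hist_add_unit i h | h in {: hist K n}]%SET]) /=.
rewrite [X in _ + X]big1 ?addr0; last first.
  move=> g gN; rewrite ffunE.
  have [/hist_add_unit_surj [h hE]|] := ltnP 0 (histv g i).
    by case/negP: gN; rewrite hE; apply: imset_f.
  by rewrite leqn0 => /eqP ->; rewrite mul0r mulr0.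
rewrite big_imset /=; last by move=> h g _ _; exact: hist_add_unit_inj.
apply: eq_bigr => h _; rewrite hist_add_unitE mulrA.
rewrite -multinomial_pmf_add_unit -hist_add_unitE ffunE.
by rewrite -pmulrn mulrA; congr (_ * _); rewrite mulrC.
Qed.

Lemma eq_multinomial_mean n phi psi :
  (forall h : hist K n, phi (hist_lattice h) = psi (hist_lattice h)) ->
  multinomial_mean n phi = multinomial_mean n psi.
Proof. by move=> e; apply: eq_bigr => h _; rewrite e. Qed.

Lemma multinomial_meanD n phi psi :
  multinomial_mean n (fun z => phi z + psi z) =
  multinomial_mean n phi + multinomial_mean n psi.
Proof. by rewrite /multinomial_mean -big_split; apply: eq_bigr => h _; rewrite mulrDr. Qed.

Lemma multinomial_meanZ n c phi :
  multinomial_mean n (fun z => c * phi z) = c * multinomial_mean n phi.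
Proof. by rewrite /multinomial_mean big_distrr /=; apply: eq_bigr => h _; rewrite mulrCA. Qed.

Lemma multinomial_meanB n phi psi :
  multinomial_mean n (fun z => phi z - psi z) =
  multinomial_mean n phi - multinomial_mean n psi.
Proof. by rewrite /multinomial_mean -sumrB; apply: eq_bigr => h _; rewrite mulrBr. Qed.

Lemma multinomial_mean_sum n (I : finType) (phi : I -> lattice K -> R) :
  multinomial_mean n (fun z => \sum_i phi i z) =
  \sum_i multinomial_mean n (phi i).
Proof.
rewrite /multinomial_mean exchange_big /=; apply: eq_bigr => h _.
by rewrite mulr_sumr.
Qed.

Hypothesis p_gt0 : forall k, 0 < p k.

Lemma multinomial_pmf_ge0 n (h : hist K n) : 0 <= multinomial_pmf h.
Proof.
apply: mulr_ge0; last by apply: prodr_ge0 => k _; exact/exprn_ge0/ltW.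
by apply: divr_ge0 => //; apply: prodr_ge0.
Qed.

Lemma ler_multinomial_mean n phi psi :
  (forall h : hist K n, phi (hist_lattice h) <= psi (hist_lattice h)) ->
  multinomial_mean n phi <= multinomial_mean n psi.
Proof.
by move=> le; apply: ler_sum => h _; apply: ler_wpM2l => //; exact: multinomial_pmf_ge0.
Qed.

Hypothesis p_sum1 : \sum_(k < K) p k = 1.

(** Induction on [n] by size-biasing: the counts add up to [n.+1], so [n.+1] times the total mass is
    the sum of the first moments [n.+1 * p i]. *)
Lemma multinomial_mean_cst n c : multinomial_mean n (fun=> c) = c.
Proof.
suff {c} : multinomial_mean n (fun=> 1) = 1.
  by move=> e; rewrite -{2}[c]mulr1 -e -multinomial_meanZ; apply: eq_multinomial_mean => h; rewrite mulr1.
elim: n => [|n IH].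
  rewrite /multinomial_mean.
  have [||h0 h0E] := @hist_of_lattice K 0 0.
  - by move=> k; rewrite ffunE.
  - by rewrite /coord_sum big1 // => k _; rewrite ffunE.
  have h00 (h : hist K 0) k : histv h k = 0%N.
    by have := ltn_ord (val h k); rewrite ltnS leqn0 => /eqP.
  rewrite (bigD1 h0) //= big1 ?addr0 => [|h /negP[]]; last first.
    by apply/eqP/hist_lattice_inj/ffunP => k; rewrite !ffunE !h00.
  rewrite /multinomial_pmf /multinom !big1 ?fact0 ?divr1 ?mulr1 // => k _.
    by rewrite h00 expr0.
  by rewrite h00 fact0.
have n0 : n.+1%:R != 0 :> R by rewrite pnatr_eq0.
apply: (mulfI n0); rewrite mulr1 -multinomial_meanZ.
rewrite (@eq_multinomial_mean _ _ (fun z => \sum_i (z i)%:~R * 1)); last first.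
  move=> h; rewrite mulr1 -[in LHS](sum_histv h) natr_sum; apply: eq_bigr => k _.
  by rewrite ffunE mulr1 -pmulrn.
rewrite multinomial_mean_sum.
under eq_bigr do rewrite (multinomial_mean_coord _ _ (fun=> 1)) IH mulr1.
by rewrite -mulr_sumr p_sum1 mulr1.
Qed.

Lemma multinomial_mean1 n i : multinomial_mean n (fun z => (z i)%:~R) = n%:R * p i.
Proof.
case: n => [|n].
  rewrite mul0r -[RHS](multinomial_mean_cst 0); apply: eq_multinomial_mean => h.
  by have := ltn_ord (val h i); rewrite ltnS leqn0 => /eqP e; rewrite ffunE /histv e.
have := multinomial_mean_coord n i (fun=> 1); rewrite multinomial_mean_cst mulr1 => <-.
by apply: eq_multinomial_mean => h; rewrite mulr1.
Qed.

Lemma multinomial_mean2 n i j :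
  multinomial_mean n.+1 (fun z => (z i)%:~R * (z j)%:~R) =
  n.+1%:R * p i * (n%:R * p j + (j == i)%:R).
Proof.
rewrite (multinomial_mean_coord n i (fun z => (z j)%:~R)); congr (_ * _).
rewrite -multinomial_mean1 -[(j == i)%:R in RHS](multinomial_mean_cst n).
rewrite -multinomial_meanD; apply: eq_multinomial_mean => h.
by rewrite !ffunE rmorphD /= -[(j == i)%:R]/((j == i)%:R : int) rmorph_nat.
Qed.

(** Both quotients have the same mean, and in the second moment of their difference the terms
    quadratic in [n] cancel, which leaves linear growth. *)
Lemma multinomial_variance n i j : i != j ->
  multinomial_mean n.+1 (fun z => ((z i)%:~R / p i - (z j)%:~R / p j) ^+ 2) =
  n.+1%:R * ((p i)^-1 + (p j)^-1).
Proof.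
move=> ij; rewrite (@eq_multinomial_mean _ _ (fun z =>
  ((p i)^-2 * ((z i)%:~R * (z i)%:~R) + (p j)^-2 * ((z j)%:~R * (z j)%:~R))
  - (2 * (p i)^-1 * (p j)^-1) * ((z i)%:~R * (z j)%:~R))); last first.
  by move=> h; field; rewrite !gt_eqF.
rewrite multinomial_meanB multinomial_meanD !multinomial_meanZ !multinomial_mean2.
rewrite !eqxx eq_sym (negbTE ij) mulr0n mulr1n.
by field; rewrite !gt_eqF.
Qed.

(* The recursion [multinomial_mean_coord] turns the difference of two shifted
   means into the mean of [phi] against the centred [z i / p i - z j / p j],
   whose second moment is linear in [n]; the last bound is AM-GM. *)
Lemma multinomial_shift_unit n i j eta phi : 0 < eta -> (forall z, `|phi z| <= 1) ->
  `|multinomial_mean n (fun z => phi (z + unit_vec i)) -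
    multinomial_mean n (fun z => phi (z + unit_vec j))| <=
  ((p i)^-1 + (p j)^-1) / eta / n.+1%:R + eta.
Proof.
move=> eta0 phi1.
have [->|ij] := eqVneq i j.
  rewrite subrr normr0; apply: addr_ge0; last exact: ltW.
  apply: divr_ge0 => //; apply: divr_ge0; last exact: ltW.
  by rewrite addr_ge0 // invr_ge0 ltW.
have n0 : 0 < n.+1%:R :> R by rewrite ltr0n.
rewrite -(ler_pM2l n0) -{1}(gtr0_norm n0) -normrM mulrBr.
have sh k : n.+1%:R * multinomial_mean n (fun z => phi (z + unit_vec k)) =
    multinomial_mean n.+1 (fun z => (z k)%:~R / p k * phi z).
  apply: (@mulfI _ (p k)); first by rewrite gt_eqF.
  rewrite mulrA [p k * _]mulrC -multinomial_mean_coord -multinomial_meanZ.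
  apply: eq_multinomial_mean => h.
  by field; rewrite gt_eqF.
rewrite !sh -multinomial_meanB.
(* The bound is [|Y| <= Y^2 / a + a]. With [a = eta * n.+1] the linear variance contributes a
   constant, and after division by [n.+1] only [eta] survives in the limit. *)
apply: (@le_trans _ _ (multinomial_mean n.+1 (fun z =>
   (eta * n.+1%:R)^-1 * ((z i)%:~R / p i - (z j)%:~R / p j) ^+ 2 + eta * n.+1%:R))).
  apply: (le_trans (ler_norm_sum _ _ _)); apply: ler_sum => h _.
  rewrite normrM ger0_norm ?multinomial_pmf_ge0 //.
  apply: ler_wpM2l; first exact: multinomial_pmf_ge0.
  rewrite -mulrBl normrM.
  set Y := _ / _ - _ / _; set a := eta * _.
  have a0 : 0 < a by rewrite mulr_gt0.
  apply: (@le_trans _ _ `|Y|); first by rewrite ler_piMr.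
  rewrite -(ler_pM2l a0) mulrDr mulVKf ?gt_eqF //.
  by rewrite -real_normK ?num_real //; nra.
rewrite multinomial_meanD multinomial_meanZ multinomial_mean_cst.
rewrite multinomial_variance //.
rewrite le_eqVlt; apply/orP; left; apply/eqP.
by field; rewrite !gt_eqF.
Qed.

(** Convergence to zero of the total variation distance between the law and its translate. The
    threshold on [n] precedes [phi], since the test functions used later depend on [n]. *)
Definition asymptotically_shift_invariant (x : lattice K) : Prop :=
  forall eps : R, 0 < eps -> \forall n \near \oo, forall phi : lattice K -> R,
    (forall z, `|phi z| <= 1) ->
    `|multinomial_mean n (fun z => phi (z + x)) - multinomial_mean n phi| <= eps.

Lemma asymptotic_shift0 : asymptotically_shift_invariant 0.
Proof.
move=> eps e0; near=> n => phi _; under eq_multinomial_mean do rewrite addr0.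
by rewrite subrr normr0 ltW.
Unshelve. all: by end_near. Qed.

Lemma asymptotic_shiftD x y : asymptotically_shift_invariant x ->
  asymptotically_shift_invariant y -> asymptotically_shift_invariant (x + y).
Proof.
move=> hx hy eps e0; have e2 : 0 < eps / 2 by lra.
apply: filterS2 (hx _ e2) (hy _ e2) => n Hx Hy phi phi1.
apply: (le_trans (ler_distD (multinomial_mean n (fun z => phi (z + x))) _ _)).
rewrite (splitr eps); apply: lerD; last exact: Hx.
apply: le_trans (Hy (fun z => phi (z + x)) (fun z => phi1 _)).
rewrite (_ : (fun z => phi (z + (x + y))) = (fun z => phi (z + y + x))) //.
by apply/funext => z; rewrite -addrA [y + x]addrC.
Qed.

Lemma asymptotic_shiftN x : asymptotically_shift_invariant x ->
  asymptotically_shift_invariant (- x).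
Proof.
move=> hx eps e0; apply: filterS (hx _ e0) => n Hx phi phi1.
rewrite distrC; apply: le_trans (Hx (fun z => phi (z - x)) (fun z => phi1 _)).
rewrite (_ : (fun z => phi (z + x - x)) = phi) //.
by apply/funext => z; rewrite addrK.
Qed.

Lemma asymptotic_shiftMz x (m : int) : asymptotically_shift_invariant x ->
  asymptotically_shift_invariant (x *~ m).
Proof.
move=> hx; have hn q : asymptotically_shift_invariant (x *+ q).
  by elim: q => [|q IH]; rewrite ?mulr0n ?mulrS; [exact: asymptotic_shift0 | exact: asymptotic_shiftD].
case: m => m; first by rewrite -pmulrn.
by rewrite NegzE mulrNz -pmulrn; exact/asymptotic_shiftN/hn.
Qed.

Lemma asymptotic_shift_unit i j : asymptotically_shift_invariant (unit_vec i - unit_vec j).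
Proof.
move=> eps e0; pose c := (p i)^-1 + (p j)^-1.
have c0 : 0 < c by rewrite addr_gt0 // invr_gt0.
near=> n => phi phi1.
have /(_ n i j (eps / 2)) := @multinomial_shift_unit _ _ _ _
  (fun z => phi (z - unit_vec j)) _ (fun z => phi1 _).
rewrite (_ : (fun z => phi (z + unit_vec i - unit_vec j)) =
             (fun z => phi (z + (unit_vec i - unit_vec j)))); last first.
  by apply/funext => z; rewrite addrA.
rewrite (_ : (fun z => phi (z + unit_vec j - unit_vec j)) = phi); last first.
  by apply/funext => z; rewrite addrK.
move=> /(_ ltac:(lra)) /le_trans; apply.
rewrite -/c [leRHS](splitr eps) lerD2r.
rewrite ler_pdivrMr ?ltr0n // -ler_pdivrMl; last by lra.
apply: (@le_trans _ _ n%:R); last by rewrite ler_nat.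
by near: n; exact: nbhs_infty_ger.
Unshelve. all: by end_near. Qed.

Lemma sum_zero_asymptotic_shift x : coord_sum x = 0 -> asymptotically_shift_invariant x.
Proof.
(* The decomposition needs a base index; if there is none, the lattice is reduced to 0. *)
move=> x0; case: (pickP [pred i : 'I_K | true]) => [i _|no].
  rewrite (sum_zero_decomposition i x0).
  apply: (big_ind asymptotically_shift_invariant); first exact: asymptotic_shift0.
    by move=> y z; exact: asymptotic_shiftD.
  by move=> k _; exact/asymptotic_shiftMz/asymptotic_shift_unit.
suff -> : x = 0 by exact: asymptotic_shift0.
by apply/ffunP => k; have := no k.
Qed.

End Multinomial.

(** * Probability mass functions on the lattice *)

Section RealEsum.
Variables (R : realType) (T : choiceType).
Implicit Types a b : T -> R.

Lemma fset_sum_le_esum a (s : {fset T}) :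
  ((\sum_(x <- s) a x)%:E <= \esum_(x in [set: T]) (a x)%:E)%E.
Proof.
apply: ereal_sup_ubound; exists [set` s]; first by split.
by rewrite fsbig_finite // set_fsetK sumEFin.
Qed.

Lemma esum_le_finP a (c : R) :
  (\esum_(x in [set: T]) (a x)%:E <= c%:E)%E <->
  forall s : {fset T}, \sum_(x <- s) a x <= c.
Proof.
split=> [le s|le].
  by rewrite -lee_fin; apply: le_trans le; exact: fset_sum_le_esum.
by apply: ge_ereal_sup => _ [X [finX _] <-]; rewrite fsbig_finite // sumEFin lee_fin.
Qed.

(** One inequality holds on finite sums; the other is the same inequality for the factor [c^-1]. *)
Lemma esumZ a (c : R) : 0 < c ->
  (\esum_(x in [set: T]) (c * a x)%:E = c%:E * \esum_(x in [set: T]) (a x)%:E)%E.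
Proof.
have le b (d : R) : 0 < d ->
  (\esum_(x in [set: T]) (d * b x)%:E <= d%:E * \esum_(x in [set: T]) (b x)%:E)%E.
  move=> d0; apply: ge_ereal_sup => _ [X [finX XT] <-].
  rewrite fsbig_finite // sumEFin -mulr_sumr EFinM lee_pmul2l //.
  by apply: ereal_sup_ubound; exists X => //; rewrite fsbig_finite // sumEFin.
move=> c0; apply/eqP; rewrite eq_le le //=.
have c0' : 0 < c^-1 by rewrite invr_gt0.
have := le (fun x => c * a x) _ c0'.
under eq_esum do rewrite mulKf ?gt_eqF //.
have c0E : (0 < c%:E)%E by rewrite lte_fin.
by rewrite -(lee_pmul2l _ c0E) // muleA -EFinM divff ?gt_eqF // mul1e.
Qed.

End RealEsum.

Section LatticePmf.
Variables (R : realType) (K : nat).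
Implicit Types f g : lattice K -> R.

Definition is_lattice_pmf f : Prop :=
  [/\ forall x, 0 <= f x, forall x, coord_sum x != 0 -> f x = 0 &
      (\esum_(x in [set: lattice K]) (f x)%:E = 1)%E].

(** A one-sided bound is enough: starting from [x + v] and using [- v] gives the other side. *)
Definition lattice_DP (theta : R) f : Prop :=
  forall x v, coord_sum v = 0 -> l1norm v = 2%N -> theta * f x <= f (x + v).

Definition lattice_cost f : \bar R :=
  (\esum_(x in [set: lattice K]) (f x * (l1norm x)%:R)%:E)%E.

Lemma finite_l1ball m : finite_set [set x : lattice K | (l1norm x <= m)%N].
Proof.
pose e (g : {ffun 'I_K -> 'I_(m + m).+1}) : lattice K := [ffun k => (g k)%:Z - m%:Z].
apply: (@sub_finite_set _ _ (e @` setT)); last exact/finite_image/finite_finset.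
move=> x /= xm.
have xk k : (`|x k| <= m)%N.
  by apply: leq_trans xm; rewrite /l1norm (bigD1 k) //= leq_addr.
exists [ffun k => inord `|x k + m%:Z|] => //.
by apply/ffunP => k; rewrite !ffunE inordK; have := xk k; move: (x k) => a; lia.
Qed.

Definition l1ball m : {fset lattice K} := fset_set [set x | (l1norm x <= m)%N].

Lemma lattice_pmf_le1 f x : is_lattice_pmf f -> f x <= 1.
Proof.
case=> f0 _ f1; have /esum_le_finP/(_ [fset x]%fset) :
  (\esum_(x in [set: lattice K]) (f x)%:E <= 1%:E)%E by rewrite f1.
by rewrite big_seq_fset1.
Qed.

(** Markov's inequality: outside the ball the norm is at least [m.+1]. *)
Lemma l1ball_mass f (c : R) m : is_lattice_pmf f -> (lattice_cost f <= c%:E)%E ->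
  1 - c / m.+1%:R <= \sum_(x <- l1ball m) f x.
Proof.
move=> [f0 _ f1] /esum_le_finP fc.
rewrite lerBlDr -lee_fin -f1 (esumID [set x | (l1norm x <= m)%N]); last first.
  by move=> x _; rewrite lee_fin.
rewrite EFinD setTI esum_fset; [|exact: finite_l1ball|by move=> *; rewrite lee_fin].
rewrite fsbig_finite; last exact: finite_l1ball.
rewrite sumEFin; apply: leeD => //; rewrite setTI esum_mkcond.
apply: (@le_trans _ _ (\esum_(x in [set: lattice K]) (f x * (l1norm x)%:R / m.+1%:R)%:E)%E).
  apply: le_esum => x _; case: ifPn => [|_]; last first.
    by rewrite lee_fin divr_ge0 // mulr_ge0.
  rewrite inE /= => /negP; rewrite -ltnNge => xm.
  rewrite lee_fin ler_pdivlMr ?ltr0n //; apply: ler_wpM2l => //.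
  by rewrite ler_nat.
apply/esum_le_finP => s; rewrite -mulr_suml ler_pM2r ?invr_gt0 ?ltr0n //; exact: fc.
Qed.

Lemma fmap_ultra (T U : Type) (F : set_system T) (u : T -> U) :
  UltraFilter F -> UltraFilter (u @ F).
Proof.
move=> UF; split; first exact: fmap_proper_filter.
move=> G PG FG; apply/seteqP; split=> // A GA.
have [//|nA] := in_ultra_setVsetC (u @^-1` A) UF.
have GnA : G (~` A) by apply: FG.
exfalso; apply: (@filter_not_empty _ G).
by rewrite -(setICr A); exact: filterI.
Qed.

Lemma cvg_sum_seq (T : Type) (F : set_system T) (I : Type) (s : seq I)
    (u : T -> I -> R) (l : I -> R) : Filter F ->
  (forall i, u^~ i @ F --> l i) ->
  (fun t => \sum_(i <- s) u t i) @ F --> \sum_(i <- s) l i.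
Proof.
move=> FF ul; elim: s => [|i s IH].
  rewrite big_nil (_ : (fun _ => _) = fun=> 0); first exact: cvg_cst.
  by apply/funext => t; rewrite big_nil.
rewrite big_cons (_ : (fun _ => _) = fun t => u t i + \sum_(j <- s) u t j).
  exact: cvgD.
by apply/funext => t; rewrite big_cons.
Qed.

(* Pointwise limit along an ultrafilter; the bounded cost makes the sequence
   tight, so no mass escapes. *)
Lemma lattice_pmf_compactness (theta : R) (f : nat -> lattice K -> R)
    (c : nat -> R) (C : R) :
  (forall n, is_lattice_pmf (f n)) ->
  (forall n, lattice_cost (f n) <= (c n)%:E)%E ->
  c @ \oo --> C ->
  (forall (eps : R) x v, 0 < eps -> coord_sum v = 0 -> l1norm v = 2%N ->
     \forall n \near \oo, theta * f n x <= f n (x + v) + eps) ->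
  exists g, [/\ is_lattice_pmf g, lattice_DP theta g & (lattice_cost g <= C%:E)%E].
Proof.
move=> fpmf fc cC fDP.
have [G [UG sG]] := ultraFilterLemma (_ : ProperFilter \oo).
have PG : ProperFilter G := @ultra_proper _ _ UG.
(* All values lie in the compact interval from 0 to 1, so each coordinate converges along the
   ultrafilter. *)
have lim x : exists l : R, f^~ x @ G --> l.
  have UFx := fmap_ultra (f^~ x) UG.
  have := @segment_compact R 0 1; rewrite compact_ultra => /(_ _ UFx) [].
    apply: (@filterE _ G) => n; rewrite /= in_itv /= (lattice_pmf_le1 _ (fpmf n)).
    by have [->] := fpmf n.
  by move=> l [_ fl]; exists l.
have {lim} [g fg] := choice lim.
have {}cC : c @ G --> C by move=> A /cC cA; apply: sG.
have gsum s (w : lattice K -> R) :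
    (fun n => \sum_(x <- s) f n x * w x) @ G --> \sum_(x <- s) g x * w x.
  by apply: cvg_sum_seq => x; apply: cvgM; [exact: fg | exact: cvg_cst].
have gsum1 s : (fun n => \sum_(x <- s) f n x) @ G --> \sum_(x <- s) g x.
  exact: cvg_sum_seq.
have g0 x : 0 <= g x.
  apply: (ler_cvg_to (cvg_cst 0) (fg x)); apply: filterE => n.
  by have [->] := fpmf n.
have gcost : (lattice_cost g <= C%:E)%E.
  apply/esum_le_finP => s; apply: (ler_cvg_to (gsum s _) cC).
  by apply: filterE => n; move: s; apply/esum_le_finP; exact: fc.
exists g; split => //.
- split => //.
    move=> x x0; have := fg x; rewrite (_ : f^~ x = cst 0); last first.
      by apply/funext => n; have [_ ->] := fpmf n.
    by move=> /(cvg_unique _ (cvg_cst 0)) => ->.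
  apply/eqP; rewrite eq_le; apply/andP; split.
    apply/(@esum_le_finP _ _ g 1) => s.
    apply: (cvgr_to_le (gsum1 s)).
    apply: filterE => n.
    by move: s; apply/esum_le_finP; have [_ _ ->] := fpmf n.
  (* Finite sums give mass at most 1. For the converse, the costs are eventually below [C + 1], so
     one fixed ball carries mass at least [1 - eps] for all these [n], hence in the limit. *)
  have C1 : 0 < C + 1.
    rewrite ltr_wpDl // -lee_fin; apply: le_trans gcost.
    by apply: esum_ge0 => x _; rewrite lee_fin mulr_ge0.
  apply/lee_addgt0Pr => eps eps0.
  have [m mE] : exists m, (C + 1) / m.+1%:R <= eps.
    exists (Num.truncn ((C + 1) / eps)).
    rewrite ler_pdivrMr ?ltr0n // mulrC -ler_pdivrMr //.
    exact/ltW/truncnS_gt.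
  rewrite -leeBlDr // -EFinB.
  apply: le_trans (fset_sum_le_esum g (l1ball m)).
  rewrite lee_fin; apply: (ler_cvg_to (cvg_cst (1 - eps)) (gsum1 _)).
  have cC1 : \forall n \near G, c n < C + 1.
    by apply: (cvgr_lt C cC); rewrite ltrDl.
  apply: filterS cC1 => n cn.
  apply: le_trans (l1ball_mass _ (fpmf n) (fc n)).
  rewrite lerD2l lerN2; apply: le_trans mE.
  by rewrite ler_pM2r ?invr_gt0 ?ltr0n // ltW.
- move=> x v v0 v2; apply/ler_addgt0Pr => eps eps0.
  have lim : (fun n => theta * f n x - f n (x + v)) @ G --> theta * g x - g (x + v).
    by apply: cvgB; [apply: cvgM; [exact: cvg_cst|] |]; exact: fg.
  rewrite -lerBlDl; apply: (cvgr_to_le lim).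
  have := sG _ (fDP eps x v eps0 v0 v2).
  by apply: filterS => n; rewrite -lerBlDl.
Qed.

End LatticePmf.

(** * A private law with finite mean norm *)

Section Geometric.
Variables (R : realType) (K : nat) (t : R).
Hypotheses (t_gt0 : 0 < t) (t_lt1 : t < 1).

Lemma geometric_sum_le m : \sum_(j < m) t ^+ j <= (1 - t)^-1.
Proof.
have t1 : 0 < 1 - t by rewrite subr_gt0.
rewrite -(ler_pM2l t1) divff ?gt_eqF //.
have -> : (1 - t) * \sum_(j < m) t ^+ j = 1 - t ^+ m.
  by rewrite -[LHS]opprK -mulNr opprB -subrX1 opprB.
by rewrite gerBl exprn_ge0 // ltW.
Qed.

(** Each of the [m] terms of the geometric sum is at least [t ^+ m]. *)
Lemma natr_geometric_le m : m%:R * t ^+ m <= (1 - t)^-1.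
Proof.
apply: le_trans (geometric_sum_le m).
rewrite mulr_natl -[X in _ *+ X](card_ord m) -sumr_const.
apply: ler_sum => j _; apply: ler_wiXn2l; rewrite ?(ltW t_gt0) ?(ltW t_lt1) //.
exact: ltnW.
Qed.

(** The weight is a product over coordinates. Coding a coordinate by its sign and absolute value
    embeds [s] in a finite product, over which the sum factors into [K] doubled geometric sums. *)
Lemma geometric_lattice_sum_le (s : {fset lattice K}) :
  \sum_(x <- s) t ^+ l1norm x <= (2 * (1 - t)^-1) ^+ K.
Proof.
pose m := (\max_(x <- s) l1norm x)%N.
pose H (g : {ffun 'I_K -> bool * 'I_m.+1}) := \prod_k t ^+ (g k).2.
pose e (x : lattice K) : {ffun 'I_K -> bool * 'I_m.+1} :=
  [ffun k => (0 <= x k, inord `|x k|%N)].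
have sm x k : x \in s -> (`|x k| < m.+1)%N.
  move=> xs; rewrite ltnS; apply: (@leq_trans (l1norm x)).
    by rewrite /l1norm (bigD1 k) //= leq_addr.
  exact: leq_bigmax_seq.
have H0 g : 0 <= H g by apply: prodr_ge0 => k _; rewrite exprn_ge0 // ltW.
have -> : \sum_(x <- s) t ^+ l1norm x = \sum_(x <- s) H (e x).
  apply: eq_big_seq => x xs; rewrite /l1norm -prodrXr.
  by apply: eq_bigr => k _; rewrite ffunE /= inordK // sm.
rewrite -(big_map e xpredT H) big_uniq /=; last first.
  rewrite map_inj_in_uniq ?fset_uniq // => x y xs ys /ffunP exy; apply/ffunP => k.
  have := exy k; rewrite !ffunE => -[sg /(congr1 val)].
  rewrite /= !inordK ?sm //; move: sg; move: (x k) (y k) => a b; lia.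
apply: (@le_trans _ _ (\sum_g H g)).
  by rewrite [leRHS](bigID [in map e s]) /= lerDl sumr_ge0.
rewrite /H -(bigA_distr_bigA (fun _ (j : bool * 'I_m.+1) => t ^+ j.2)) /=.
rewrite prodr_const card_ord; apply: lerXn2r; rewrite ?nnegrE.
- by apply: sumr_ge0 => j _; rewrite exprn_ge0 // ltW.
- by rewrite mulr_ge0 // invr_ge0 subr_ge0 ltW.
rewrite -(pair_big xpredT xpredT (fun (b : bool) (j : 'I_m.+1) => t ^+ j)) /=.
rewrite big_bool /= mulr_natl mulr2n.
by apply: lerD; exact: geometric_sum_le.
Qed.

End Geometric.

(** The witness is the normalized weight [s ^+ l1norm x] on the sum-zero sublattice. With [s] the
    square root of [theta], a step of norm 2 costs at most the factor [theta]. Writing [s = t ^+ 2],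
    one power of [t] absorbs the norm and the other remains summable. *)
Lemma lattice_DP_exists (R : realType) (K : nat) (theta : R) : 0 < theta < 1 ->
  exists (f : lattice K -> R) (c : R),
    [/\ is_lattice_pmf f, lattice_DP theta f & (lattice_cost f <= c%:E)%E].
Proof.
move=> /andP[th0 th1]; pose s := Num.sqrt theta; pose t := Num.sqrt s.
have s0 : 0 < s by rewrite sqrtr_gt0.
have t0 : 0 < t by rewrite sqrtr_gt0.
have sE : s ^+ 2 = theta by rewrite sqr_sqrtr // ltW.
have tE : t ^+ 2 = s by rewrite sqr_sqrtr // ltW.
have s1 : s < 1 by nra.
have t1 : t < 1 by nra.
pose w (x : lattice K) := if coord_sum x == 0 then s ^+ l1norm x else 0.
have w0 x : 0 <= w x by rewrite /w; case: ifP => // _; rewrite exprn_ge0 // ltW.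
have ws x : w x <= s ^+ l1norm x.
  by rewrite /w; case: ifP => // _; rewrite exprn_ge0 // ltW.
have wt x : w x <= t ^+ l1norm x.
  apply: le_trans (ws x) _; apply: lerXn2r; rewrite ?nnegrE ?ltW //.
  by rewrite -tE expr2 gtr_pMl.
have wlt x : w x * (l1norm x)%:R <= t ^+ l1norm x * (1 - t)^-1.
  apply: (@le_trans _ _ (s ^+ l1norm x * (l1norm x)%:R)); first by rewrite ler_wpM2r.
  rewrite -tE expr2 exprMn -mulrA ler_wpM2l //; first by rewrite exprn_ge0 // ltW.
  by rewrite mulrC; exact: natr_geometric_le.
pose B := (2 * (1 - t)^-1) ^+ K.
have wB : (\esum_(x in [set: lattice K]) (w x)%:E <= B%:E)%E.
  apply/esum_le_finP => q; apply: le_trans (geometric_lattice_sum_le t0 t1 q).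
  by apply: ler_sum => x _.
(* The origin alone has weight 1, so the normalizing constant is positive. *)
have w1 : (1 <= \esum_(x in [set: lattice K]) (w x)%:E)%E.
  apply: le_trans (fset_sum_le_esum w [fset 0]%fset).
  rewrite big_seq_fset1 /w /coord_sum /l1norm !big1 ?eqxx ?expr0 // => k _;
  by rewrite ffunE.
pose Z := fine (\esum_(x in [set: lattice K]) (w x)%:E)%E.
have ZE : (\esum_(x in [set: lattice K]) (w x)%:E)%E = Z%:E.
  rewrite fineK // ge0_fin_numE; first exact: le_lt_trans wB (ltry _).
  exact: le_trans w1.
have Z0 : 0 < Z by apply: (@lt_le_trans _ _ 1) => //; rewrite -lee_fin -ZE.
exists (fun x => Z^-1 * w x), (Z^-1 * (B * (1 - t)^-1)); split.
- split.
  + by move=> x; rewrite mulr_ge0 // invr_ge0 ltW.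
  + by move=> x x0; rewrite /w (negbTE x0) mulr0.
  + by rewrite esumZ ?invr_gt0 // ZE -EFinM mulVf ?gt_eqF.
- move=> x v v0 v2; rewrite mulrCA ler_pM2l ?invr_gt0 // /w coord_sumD v0 addr0.
  case: ifP => _; last by rewrite mulr0.
  rewrite -sE -exprD; apply: ler_wiXn2l; [exact: ltW | exact: ltW |].
  by apply: leq_trans (l1norm_triangle _ _) _; rewrite v2 addnC.
- apply/esum_le_finP => q; under eq_bigr do rewrite -mulrA.
  rewrite -mulr_sumr ler_pM2l ?invr_gt0 //.
  apply: (@le_trans _ _ (\sum_(x <- q) t ^+ l1norm x * (1 - t)^-1)).
    exact: ler_sum.
  rewrite -mulr_suml ler_wpM2r ?geometric_lattice_sum_le // invr_ge0; lra.
Qed.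

(** * Translation mechanisms and projection *)

Lemma optimal_lattice_pmf (R : realType) (K : nat) (theta : R) : 0 < theta < 1 ->
  exists (f : lattice K -> R) (D : R),
    [/\ is_lattice_pmf f, lattice_DP theta f, lattice_cost f = D%:E &
     forall g : lattice K -> R, is_lattice_pmf g -> lattice_DP theta g ->
       (D%:E <= lattice_cost g)%E].
Proof.
move=> theta01.
(* Real upper bounds of costs are collected rather than the costs themselves, which are extended
   reals and may be infinite. *)
pose S := [set c : R | exists g : lattice K -> R,
  [/\ is_lattice_pmf g, lattice_DP theta g & (lattice_cost g <= c%:E)%E]].
have cost0 (g : lattice K -> R) : is_lattice_pmf g -> (0 <= lattice_cost g)%E.
  by case=> g0 _ _; apply: esum_ge0 => x _; rewrite lee_fin mulr_ge0.
have S_inf : has_inf S.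
  split; first by have [f [c fc]] := lattice_DP_exists K theta01; exists c, f.
  exists 0 => c [g [gpmf _ gc]]; rewrite -lee_fin; apply: le_trans gc; exact: cost0.
pose D := inf S.
have Dmin (g : lattice K -> R) : is_lattice_pmf g -> lattice_DP theta g ->
    (D%:E <= lattice_cost g)%E.
  move=> gpmf gDP; have := cost0 g gpmf.
  case E : (lattice_cost g) => [c| |] //; last by rewrite !leey.
  move=> _; rewrite lee_fin; apply: ge_inf; first by case: S_inf.
  by exists g; rewrite E.
have /choice[F FP] n : exists g : lattice K -> R, [/\ is_lattice_pmf g,
    lattice_DP theta g & (lattice_cost g <= (D + n.+1%:R^-1)%:E)%E].
  have [|c [g [gpmf gDP gc]] cD] := inf_adherent (_ : 0 < n.+1%:R^-1) S_inf.
    by rewrite invr_gt0.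
  by exists g; split=> //; apply: le_trans gc _; rewrite lee_fin ltW.
have [||||f [fpmf fDP fD]] := @lattice_pmf_compactness _ _ theta F
    (fun n => D + n.+1%:R^-1) D.
- by move=> n; have [] := FP n.
- by move=> n; have [] := FP n.
- rewrite -[X in _ --> X]addr0; apply: cvgD; first exact: cvg_cst.
  exact: cvg_harmonic.
- move=> eps x v e0 v0 v2; apply: nearW => n; have [_ nDP _] := FP n.
  by apply: (le_trans (nDP x v v0 v2)); rewrite lerDl ltW.
exists f, D; split=> //; apply/eqP; rewrite eq_le fD /=; exact: Dmin.
Qed.

(** * Post-processing *)

Section Cascade.
Variables (R : realType) (K n : nat) (B : choiceType).
Variables (U : B -> hist K n -> R) (V : hist K n -> B -> R).
Hypotheses (U_mech : is_mechanism U) (V_mech : is_mech_to_hist V).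

Lemma mech_to_hist_le1 g b : V g b <= 1.
Proof.
have [V0 <-] := V_mech b; rewrite (bigD1 g) //= lerDl; exact: sumr_ge0.
Qed.

(** The sum under [fine] is dominated by the total mass of [U], hence finite, so [fine] loses
    nothing. *)
Lemma cascadeE g h :
  ((cascade U V g h)%:E = \esum_(b in [set: B]) (U b h * V g b)%:E)%E.
Proof.
have [U0 U1] := U_mech h; rewrite /cascade fineK // ge0_fin_numE; last first.
  by apply: esum_ge0 => b _; rewrite lee_fin mulr_ge0 //; have [] := V_mech b.
apply: (@le_lt_trans _ _ 1%:E); last exact: ltry.
rewrite -U1; apply: le_esum => b _.
by rewrite lee_fin ler_piMr // mech_to_hist_le1.
Qed.

Lemma cascade_mean h (w : hist K n -> R) : (forall g, 0 <= w g) ->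
  ((\sum_g cascade U V g h * w g)%:E =
   \esum_(b in [set: B]) (U b h * \sum_g V g b * w g)%:E)%E.
Proof.
move=> w0; have [U0 _] := U_mech h.
have V0 g b : 0 <= V g b by have [] := V_mech b.
under [RHS]eq_esum do rewrite mulr_sumr -sumEFin.
rewrite esum_sum => [|b g _ _]; last by rewrite lee_fin !mulr_ge0.
rewrite -sumEFin; apply: eq_bigr => g _.
(* A zero weight is treated apart because [esumZ] asks for a positive factor. *)
have := w0 g; rewrite le_eqVlt => /predU1P[<-|wg].
  by rewrite mulr0 esum1 // => b _; rewrite !mulr0.
under eq_esum do rewrite mulrA mulrC.
by rewrite esumZ // -cascadeE mulrC EFinM.
Qed.

Lemma cascade_HSM : is_HSM (cascade U V).
Proof.
move=> h; have [U0 U1] := U_mech h; split=> [g|].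
  by apply: fine_ge0; apply: esum_ge0 => b _; rewrite lee_fin mulr_ge0 //; have [] := V_mech b.
have := @cascade_mean h (fun=> 1) (fun _ => ler01).
under [X in X%:E = _]eq_bigr do rewrite mulr1.
rewrite (_ : (\esum_(b in _) _)%E = 1%:E) => [[]//|].
rewrite -U1; apply: eq_esum => b _.
by under eq_bigr do rewrite mulr1; have [_ ->] := V_mech b; rewrite mulr1.
Qed.

(** Since [V] does not see [h], the bounds on [U] can be averaged against it term by term. *)
Lemma cascade_DP theta : 0 < theta -> is_DP theta U -> is_DP theta (cascade U V).
Proof.
move=> th0 UDP h h' hh' g.
have V0 b : 0 <= V g b by have [] := V_mech b.
have thV : 0 < theta^-1 by rewrite invr_gt0.
rewrite -!lee_fin !EFinM !cascadeE -!esumZ //.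
by split; apply: le_esum => b _; have [] := UDP h h' hh' b => l1 l2;
  rewrite lee_fin mulrA ler_wpM2r.
Qed.

End Cascade.

Section Translation.
Variables (R : realType) (K : nat).

Lemma esum_translate (F : lattice K -> \bar R) z :
  \esum_(b in [set: lattice K]) F (b - z) = \esum_(x in [set: lattice K]) F x.
Proof.
rewrite (@reindex_esum _ _ _ setT setT (fun x => x + z)) //.
  by apply: eq_esum => x _; rewrite addrK.
split=> // [x y _ _|x _]; first exact: addIr.
by exists (x - z); rewrite ?subrK.
Qed.

Variables (theta : R) (f : lattice K -> R).
Hypotheses (theta_gt0 : 0 < theta) (f_pmf : is_lattice_pmf f).
Hypothesis (f_DP : lattice_DP theta f).

Definition translation_mechanism n (b : lattice K) (h : hist K n) : R :=
  f (b - hist_lattice h).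

Lemma translation_mechanismP n : is_mechanism (@translation_mechanism n).
Proof.
move=> h; have [f0 _ f1] := f_pmf; split=> [b|]; first exact: f0.
by rewrite (esum_translate (fun x => (f x)%:E)).
Qed.

Lemma neighboring_l1norm n (h h' : hist K n) :
  neighboring R h h' <-> l1norm (hist_lattice h - hist_lattice h') = 2%N.
Proof.
rewrite /neighboring l1dist_l1norm; split=> [|->//].
by move=> /eqP; rewrite eqr_nat => /eqP.
Qed.

Lemma coord_sum_histB n (h h' : hist K n) :
  coord_sum (hist_lattice h - hist_lattice h') = 0.
Proof. by rewrite coord_sumD coord_sumN !coord_sum_hist subrr. Qed.

Lemma translation_mechanism_DP n : is_DP theta (@translation_mechanism n).
Proof.
move=> h h' /neighboring_l1norm hh' b; rewrite /translation_mechanism.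
have -> : b - hist_lattice h' = b - hist_lattice h + (hist_lattice h - hist_lattice h').
  by rewrite addrA subrK.
(* The second bound is the first one with [h] and [h'] exchanged. *)
split; first by apply: f_DP => //; exact: coord_sum_histB.
rewrite ler_pdivlMl //.
set y := b - _ + _; have -> : b - hist_lattice h = y + (hist_lattice h' - hist_lattice h).
  by rewrite /y !addrA !subrK.
apply: f_DP; first exact: coord_sum_histB.
by rewrite -hh' -[in RHS]l1normN opprB.
Qed.

End Translation.

Section Projection.
Variables (R : realType) (K n : nat) (h0 : hist K n).

Definition nearest_hist (b : lattice K) : hist K n :=
  [arg min_(g < h0) l1norm (b - hist_lattice g)%R]%N.

Lemma nearest_hist_min b (g : hist K n) :
  (l1norm (b - hist_lattice (nearest_hist b))%R <= l1norm (b - hist_lattice g)%R)%N.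
Proof. by rewrite /nearest_hist; case: arg_minnP => // g' _; apply. Qed.

(** Projection fixes a point of [H^n]. Elsewhere the triangle inequality and minimality at most
    double the distance, so the extra cost is charged only to exits from [H^n]. *)
Lemma nearest_hist_dist b h :
  l1dist R h (nearest_hist b) <=
  (l1norm (b - hist_lattice h))%:R * (1 + (~~ in_hist n b)%:R).
Proof.
have [/in_histP[g gE]|_] /= := boolP (in_hist n b).
  have := nearest_hist_min b g; rewrite gE subrr.
  rewrite (_ : l1norm 0 = 0%N); last by apply: big1 => k _; rewrite ffunE.
  rewrite leqn0 => /eqP/l1norm_eq0/eqP; rewrite subr_eq0 => /eqP bE.
  by rewrite addr0 mulr1 l1dist_l1norm -bE -l1normN opprB.
rewrite l1dist_l1norm -mulr2n -natrM ler_nat muln2 -addnn.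
have -> : hist_lattice h - hist_lattice (nearest_hist b) =
    - (b - hist_lattice h) + (b - hist_lattice (nearest_hist b)).
  by rewrite opprB addrA subrK.
apply: leq_trans (l1norm_triangle _ _) _.
by rewrite l1normN leq_add2l nearest_hist_min.
Qed.

Definition project_hist (g : hist K n) (b : lattice K) : R := (g == nearest_hist b)%:R.

Lemma project_hist_mean b (w : hist K n -> R) :
  \sum_g project_hist g b * w g = w (nearest_hist b).
Proof.
rewrite (bigD1 (nearest_hist b)) //= /project_hist eqxx mul1r big1 ?addr0 //.
by move=> g /negbTE ->; rewrite mul0r.
Qed.

Lemma project_histP : is_mech_to_hist project_hist.
Proof.
move=> b; split=> [g|]; first exact: ler0n.
by have := project_hist_mean b (fun=> 1); under eq_bigr do rewrite mulr1.
Qed.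

End Projection.

(** * Upper and lower bounds *)

Lemma Dn_multinomial (R : realType) K n (W : hist K n -> hist K n -> R) p :
  Dn W p = \sum_h multinomial_pmf p h * \sum_g W g h * l1dist R h g.
Proof.
apply: eq_bigr => h _; rewrite mulr_sumr; apply: eq_bigr => g _.
by rewrite /multinomial_pmf !mulrA.
Qed.

Section UpperBound.
Variables (R : realType) (K : nat) (f : lattice K -> R) (D : R).
Hypotheses (f_pmf : is_lattice_pmf f) (f_cost : lattice_cost f = D%:E).

Let cost x := f x * (l1norm x)%:R.

Let cost_ge0 x : 0 <= cost x.
Proof. by rewrite mulr_ge0 //; have [] := f_pmf. Qed.

Lemma lattice_cost_tail (eps : R) : 0 < eps ->
  exists s : {fset lattice K},
    (\esum_(x in ~` [set` s]) (cost x)%:E <= eps%:E)%E.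
Proof.
move=> eps0.
have [s sD] : exists s : {fset lattice K}, D - eps < \sum_(x <- s) cost x.
  apply: contrapT => /forallNP ns.
  have /esum_le_finP : forall s : {fset lattice K}, \sum_(x <- s) cost x <= D - eps.
    by move=> s; rewrite leNgt; apply/negP/ns.
  by rewrite [X in (X <= _)%E]f_cost lee_fin; lra.
exists s.
have := f_cost; rewrite /lattice_cost (esumID [set` s]) => [|x _]; last first.
  by rewrite lee_fin cost_ge0.
rewrite !setTI esum_fset //; last by move=> x _; rewrite lee_fin cost_ge0.
rewrite fsbig_finite // set_fsetK sumEFin -/(cost _).
case: (\esum_(x in _) _)%E => [c| |] //= [].
by rewrite lee_fin; move: sD; rewrite /cost; lra.
Qed.

(** The undoubled displacement costs [D]. In the extra term, exits are recorded for the finitely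
    many displacements in [s] and bounded by 1 outside, where the tail costs at most [eps]. *)
Lemma projected_translation_cost n (h0 h : hist K n) (s : {fset lattice K}) (eps : R) :
  (\esum_(x in ~` [set` s]) (cost x)%:E <= eps%:E)%E ->
  \sum_g cascade (@translation_mechanism R K f n) (project_hist R h0) g h * l1dist R h g
  <= D + eps + \sum_(x <- s) cost x * (~~ in_hist n (hist_lattice h + x))%:R.
Proof.
move=> tail; rewrite -lee_fin cascade_mean; first last.
- by move=> g; rewrite l1dist_l1norm.
- exact: project_histP.
- exact: translation_mechanismP.
pose out x : R := (~~ in_hist n (hist_lattice h + x))%:R.
apply: (@le_trans _ _ (\esum_(b in [set: lattice K])
    ((cost (b - hist_lattice h))%:E +
     (cost (b - hist_lattice h) * out (b - hist_lattice h)%R)%:E))%E).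
  apply: le_esum => b _; rewrite project_hist_mean -EFinD lee_fin /cost /translation_mechanism.
  rewrite -mulrA -mulrDr; apply: ler_wpM2l; first by have [] := f_pmf.
  apply: le_trans (nearest_hist_dist _ _ _ _) _.
  by rewrite mulrDr mulr1 /out [hist_lattice h + _]addrC subrK.
rewrite (esum_translate (fun x => (cost x)%:E + (cost x * out x)%:E)%E).
rewrite esumD; [|by move=> *; rewrite lee_fin cost_ge0
  |by move=> *; rewrite lee_fin mulr_ge0 ?cost_ge0].
rewrite -addrA EFinD; apply: leeD; first by rewrite -f_cost.
rewrite (esumID [set` s]) => [|x _]; last by rewrite lee_fin mulr_ge0.
rewrite !setTI esum_fset //; last by move=> x _; rewrite lee_fin mulr_ge0.
rewrite fsbig_finite // set_fsetK sumEFin addrC EFinD; apply: leeD => //.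
apply: le_trans tail; apply: le_esum => x _; rewrite lee_fin ler_piMr //.
by rewrite /out; case: in_hist.
Qed.

Variables (p : 'I_K -> R).
Hypotheses (p_gt0 : forall k, 0 < p k) (p_sum1 : \sum_(k < K) p k = 1).

(** The unshifted law never leaves [H^n], so the exit indicator has mean 0 under it, and a mean
    close to 0 under the shifted law. *)
Lemma multinomial_exit x : coord_sum x = 0 ->
  (fun n => multinomial_mean p n (fun z => (~~ in_hist n (z + x))%:R)) @ \oo --> 0.
Proof.
move=> x0; apply/cvgrPdist_le => eps eps0.
apply: filterS (sum_zero_asymptotic_shift p_gt0 p_sum1 x0 eps0) => n.
move=> /(_ (fun z => (~~ in_hist n z)%:R)) H; rewrite distrC subr0.
rewrite -[X in `|X|]subr0 -[X in _ - X](multinomial_mean_cst p_sum1 n).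
rewrite (_ : multinomial_mean p n (fun=> 0) =
  multinomial_mean p n (fun z => (~~ in_hist n z)%:R)); last first.
  by apply: eq_multinomial_mean => h; rewrite in_hist_lattice.
by apply: H => z; case: in_hist; rewrite ?normr0 ?normr1.
Qed.

Lemma upper_bound (h0 : forall n, hist K n) (eps : R) : 0 < eps ->
  \forall n \near \oo,
    Dn (cascade (@translation_mechanism R K f n) (project_hist R (h0 n))) p <= D + eps.
Proof.
move=> eps0; have e2 : 0 < eps / 2 by lra.
have [s tail] := lattice_cost_tail e2.
pose exit n x := multinomial_mean p n (fun z => (~~ in_hist n (z + x))%:R).
have lim : (fun n => \sum_(x <- s) cost x * exit n x) @ \oo --> 0.
  rewrite [X in _ --> X](_ : 0 = \sum_(x <- s) (0 : R)); last by rewrite big1.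
  apply: cvg_sum_seq => x.
  (* A displacement of nonzero sum always exits, but [f] gives it no mass. *)
  have [x0|/eqP x0] := pselect (coord_sum x = 0).
    rewrite -(mulr0 (cost x)); apply: cvgM; first exact: cvg_cst.
    exact: multinomial_exit.
  have [_ f0 _] := f_pmf; rewrite /cost f0 //.
  under eq_fun do rewrite !mul0r.
  exact: cvg_cst.
apply: filterS (cvgr_le 0 lim _ e2) => n exit_small.
rewrite Dn_multinomial.
apply: (@le_trans _ _ (multinomial_mean p n (fun z => D + eps / 2 +
    \sum_(x <- s) cost x * (~~ in_hist n (z + x))%:R))).
  apply: ler_sum => h _; apply: ler_wpM2l; first exact: multinomial_pmf_ge0.
  exact: projected_translation_cost.
rewrite multinomial_meanD multinomial_mean_cst //.
rewrite [X in _ <= _ + X](splitr eps) [leRHS]addrA lerD2l.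
rewrite (_ : multinomial_mean _ _ _ = \sum_(x <- s) cost x * exit n x) //.
rewrite /exit /multinomial_mean.
under eq_bigr do rewrite mulr_sumr.
rewrite exchange_big /=; apply: eq_bigr => x _; rewrite mulr_sumr.
by apply: eq_bigr => h _; rewrite mulrCA.
Qed.

End UpperBound.

(** * Lower bound through the law of the displacement *)

Section LowerBound.
Variables (R : realType) (K : nat) (theta : R) (p : 'I_K -> R).
Hypotheses (theta01 : 0 < theta < 1).
Hypotheses (p_gt0 : forall k, 0 < p k) (p_sum1 : \sum_(k < K) p k = 1).

Section Displacement.
Variables (n : nat) (W : hist K n -> hist K n -> R).
Hypotheses (W_HSM : is_HSM W) (W_DP : is_DP theta W).

(** Extension of [W] by zero to all pairs of lattice points, so that its arguments can be shifted
    freely. Each sum has at most one term, as [hist_lattice] is injective. *)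
Definition extend_HSM (y z : lattice K) : R :=
  \sum_(h | hist_lattice h == z) \sum_(g | hist_lattice g == y) W g h.

Lemma extend_HSME y h :
  extend_HSM y (hist_lattice h) = \sum_(g | hist_lattice g == y) W g h.
Proof.
rewrite /extend_HSM (big_pred1 h) // => h' /=.
by rewrite (inj_eq (@hist_lattice_inj K n)).
Qed.

Lemma extend_HSM_ge0 y z : 0 <= extend_HSM y z.
Proof.
by apply: sumr_ge0 => h _; apply: sumr_ge0 => g _; have [] := W_HSM h.
Qed.

Lemma extend_HSM_le1 y z : extend_HSM y z <= 1.
Proof.
have [/in_histP[h <-]|zN] := boolP (in_hist n z).
  rewrite extend_HSME; have [W0 <-] := W_HSM h.
  by rewrite [leRHS](bigID (fun g => hist_lattice g == y)) /= lerDl sumr_ge0.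
rewrite /extend_HSM big_pred0 // => h; apply/negP => /eqP hz.
by case/negP: zN; rewrite -hz in_hist_lattice.
Qed.

Definition displacement_pmf (x : lattice K) : R :=
  multinomial_mean p n (fun z => extend_HSM (z + x) z).

Lemma esum_pred1 (T : choiceType) (a : T -> R) y : 0 <= a y ->
  (\esum_(x in [set: T]) (a x * (x == y)%:R)%:E = (a y)%:E)%E.
Proof.
move=> ay; rewrite -[RHS]/((fun x => (a x)%:E) y) -(esum_set1 (t := y)) //.
rewrite [RHS]esum_mkcond; apply: eq_esum => x _.
case: ifPn => [|]; first by rewrite inE /= => ->; rewrite eqxx mulr1.
by rewrite notin_setE /= => /eqP/negbTE ->; rewrite mulr0.
Qed.

(** Each pair [h], [g] contributes to the single displacement [x = g - h]; the rest is an exchange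
    of nonnegative sums. *)
Lemma displacement_mean (w : lattice K -> R) : (forall x, 0 <= w x) ->
  (\esum_(x in [set: lattice K]) (displacement_pmf x * w x)%:E =
   (\sum_h multinomial_pmf p h *
      \sum_g W g h * w (hist_lattice g - hist_lattice h)%R)%:E)%E.
Proof.
move=> w0; have W0 g h : 0 <= W g h by have [] := W_HSM h.
pose a h g x := multinomial_pmf p h * (W g h * w x).
have a0 h g x : 0 <= a h g x.
  by rewrite /a mulr_ge0 ?multinomial_pmf_ge0 ?mulr_ge0.
transitivity (\esum_(x in [set: lattice K]) \sum_h \sum_g
   (a h g x * (x == hist_lattice g - hist_lattice h)%:R)%:E)%E.
  apply: eq_esum => x _; rewrite /displacement_pmf /multinomial_mean mulr_suml.
  rewrite -sumEFin; apply: eq_bigr => h _; rewrite sumEFin extend_HSME; congr EFin.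
  rewrite mulr_sumr mulr_suml big_mkcond /=; apply: eq_bigr => g _.
  rewrite [x == _]eq_sym subr_eq [x + _]addrC.
  by case: eqP => _; rewrite ?mulr0 // mulr1 -mulrA.
rewrite esum_sum => [|x h _ _]; last first.
  by apply: sume_ge0 => g _; rewrite lee_fin mulr_ge0.
rewrite -sumEFin; apply: eq_bigr => h _.
rewrite esum_sum => [|x g _ _]; last by rewrite lee_fin mulr_ge0.
by rewrite mulr_sumr -sumEFin; apply: eq_bigr => g _; rewrite esum_pred1.
Qed.

Lemma displacement_pmfP : is_lattice_pmf displacement_pmf.
Proof.
split=> [x|x x0|].
- by apply: sumr_ge0 => h _; rewrite mulr_ge0 ?multinomial_pmf_ge0 ?extend_HSM_ge0.
- rewrite -[RHS](multinomial_mean_cst p_sum1 n).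
  apply: eq_multinomial_mean => h; rewrite extend_HSME big_pred0 // => g.
  apply/negP => /eqP /(congr1 (@coord_sum K)) /eqP.
  by rewrite coord_sumD !coord_sum_hist eq_sym -subr_eq0 addrC addKr (negbTE x0).
- have := @displacement_mean (fun=> 1) (fun _ => ler01).
  under eq_esum do rewrite mulr1.
  move=> ->; congr EFin; rewrite -[RHS](multinomial_mean_cst p_sum1 n).
  apply: eq_bigr => h _; congr (_ * _).
  by under eq_bigr do rewrite mulr1; have [] := W_HSM h.
Qed.

Lemma displacement_cost : lattice_cost displacement_pmf = (Dn W p)%:E.
Proof.
rewrite /lattice_cost (displacement_mean (w := fun x => (l1norm x)%:R)) //.
rewrite Dn_multinomial; congr EFin; apply: eq_bigr => h _; congr (_ * _).
by apply: eq_bigr => g _; rewrite l1dist_l1norm -l1normN opprB.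
Qed.

(* Replacing [h] by [h - v] changes [W] by a factor [theta] at most, and the
   near shift-invariance of the multinomial law absorbs the change of [h]. *)
Lemma displacement_DP (eps : R) x v : l1norm v = 2%N ->
  (forall phi : lattice K -> R, (forall z, `|phi z| <= 1) ->
    `|multinomial_mean p n (fun z => phi (z - v)) - multinomial_mean p n phi| <= eps) ->
  theta * displacement_pmf x <= displacement_pmf (x + v) + (eps + eps).
Proof.
move=> v2 shift; have [th0 th1] := andP theta01.
(* Where [h - v] leaves [H^n], privacy says nothing and the trivial bound 1 is used, written as
   [1 - chi]. One [eps] pays for shifting [psi], the other for these exits. *)
pose psi z := extend_HSM (z + (x + v)) z; pose chi (z : lattice K) : R := (in_hist n z)%:R.
have psi1 z : `|psi z| <= 1 by rewrite ger0_norm ?extend_HSM_ge0 ?extend_HSM_le1.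
have chi1 z : `|chi z| <= 1 by rewrite /chi; case: in_hist; rewrite ?normr0 ?normr1.
have := shift _ psi1; have := shift _ chi1.
rewrite !ler_distl => /andP[Hchi _] /andP[_ Hpsi].
have Echi : multinomial_mean p n chi = 1.
  rewrite -[RHS](multinomial_mean_cst p_sum1 n).
  by apply: eq_multinomial_mean => h; rewrite /chi in_hist_lattice.
rewrite Echi in Hchi.
have : theta * displacement_pmf x <=
    multinomial_mean p n (fun z => psi (z - v) + (1 - chi (z - v))).
  rewrite /displacement_pmf -multinomial_meanZ; apply: ler_multinomial_mean => // h.
  rewrite /psi [x + v]addrC [hist_lattice h - v + _]addrA subrK.
  rewrite /chi; have [/in_histP[h' h'E]|_] /= := boolP (in_hist n (hist_lattice h - v)).
    rewrite subrr addr0 -h'E !extend_HSME mulr_sumr; apply: ler_sum => g _.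
    have hh' : neighboring R h h'.
      by apply/neighboring_l1norm; rewrite h'E opprB addrC subrK.
    by have [] := W_DP hh' g.
  rewrite subr0; apply: (@le_trans _ _ 1); last by rewrite lerDr extend_HSM_ge0.
  rewrite mulr_ile1 ?extend_HSM_ge0 ?extend_HSM_le1 // ltW //.
rewrite multinomial_meanD multinomial_meanB multinomial_mean_cst //.
move: Hchi Hpsi; rewrite -[multinomial_mean p n psi]/(displacement_pmf (x + v)).
by set A := multinomial_mean _ _ _; set A' := multinomial_mean _ _ _; lra.
Qed.

End Displacement.

(** Otherwise mechanisms of distortion at most [D - eps] exist for arbitrarily large sizes. Their
    displacement laws have a limit law that is exactly private, of cost at most [D - eps], against
    the minimality of [D]. *)
Lemma lower_bound (D eps : R) : 0 < eps ->
  (forall g : lattice K -> R, is_lattice_pmf g -> lattice_DP theta g ->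
    (D%:E <= lattice_cost g)%E) ->
  (forall n, exists W : hist K n -> hist K n -> R, is_HSM W /\ is_DP theta W) ->
  \forall n \near \oo, D - eps <= Dn_star n theta p.
Proof.
move=> eps0 Dmin HW; apply: contrapT => notnear.
have bad N : exists m (W : hist K m -> hist K m -> R),
    [/\ (N <= m)%N, is_HSM W, is_DP theta W & Dn W p <= D - eps].
  apply: contrapT => no; apply: notnear; exists N => // m /= Nm.
  rewrite leNgt; apply/negP => lt.
  (* Extracting a mechanism below the bound requires the set under [inf] to be nonempty, which [HW]
     provides. *)
  have [|_ [W [W1 W2] <-] WD] := inf_lt _ lt.
    by have [W] := HW m; exists (Dn W p), W.
  by apply: no; exists m, W; split=> //; exact: ltW.
have [m mP] := choice bad.
(* The mechanisms have types depending on [m N]; their displacement laws all live on one lattice,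
   where compactness applies. *)
have /choice[F FP] N : exists f : lattice K -> R,
    [/\ is_lattice_pmf f, (lattice_cost f <= (D - eps)%:E)%E &
     forall (e : R) x v, l1norm v = 2%N ->
       (forall phi : lattice K -> R, (forall z, `|phi z| <= 1) ->
         `|multinomial_mean p (m N) (fun z => phi (z - v)) -
           multinomial_mean p (m N) phi| <= e) ->
       theta * f x <= f (x + v) + (e + e)].
  have [W [_ W1 W2 WD]] := mP N.
  exists (displacement_pmf W); split; first exact: displacement_pmfP.
    by rewrite displacement_cost // lee_fin.
  by move=> e x v; exact: displacement_DP.
have [||||g [gpmf gDP]] := @lattice_pmf_compactness _ _ theta F
    (fun=> D - eps) (D - eps).
- by move=> N; have [] := FP N.
- by move=> N; have [] := FP N.
- exact: cvg_cst.
- move=> e x v e0 v0 v2.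
  have Nv0 : coord_sum (- v) = 0 by rewrite coord_sumN v0 oppr0.
  have e2 : 0 < e / 2 by lra.
  have [M _ MP] := sum_zero_asymptotic_shift p_gt0 p_sum1 Nv0 e2.
  exists M => // N /= MN; have [_ _ FN] := FP N.
  rewrite [e in leRHS](splitr e); apply: FN => //.
  by apply: MP => /=; have [W [Nm _ _ _]] := mP N; exact: leq_trans Nm.
by move=> /(le_trans (Dmin g gpmf gDP)); rewrite lee_fin; lra.
Qed.

End LowerBound.

Theorem theorem2 (R : realType) (K : nat) (theta : R) :
  (2 <= K)%N -> 0 < theta < 1 ->
  exists (Hext : nat -> choiceType)
         (U : forall n, Hext n -> hist K n -> R),
    (forall n, is_mechanism (U n) /\ is_DP theta (U n)) /\
    forall p : 'I_K -> R,
      (forall k, 0 < p k) -> \sum_(k < K) p k = 1 ->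
      exists V : forall n, hist K n -> Hext n -> R,
        (forall n, is_mech_to_hist (V n)) /\
        (forall n, is_HSM (cascade (U n) (V n)) /\
                   is_DP theta (cascade (U n) (V n))) /\
        cvgn (fun n => Dn_star n theta p) /\
        (fun n => Dn (cascade (U n) (V n)) p) @ \oo --> DK_star theta p.
Proof.
move=> K2 theta01; have [th0 _] := andP theta01.
have i0 : 'I_K := Ordinal (ltnW K2).
(* All [n] samples in one class: the default value that [nearest_hist] needs. *)
have h0 n : hist K n.
  have [||h _] := @hist_of_lattice K n [ffun k => (n * (k == i0))%N%:Z].
  - by move=> k; rewrite ffunE.
  - rewrite /coord_sum (bigD1 i0) //= big1 => [|k /negbTE ki].
      by rewrite ffunE eqxx muln1 addr0.
    by rewrite ffunE ki muln0.
  exact: h.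
have [f [D [f_pmf f_DP f_cost f_min]]] := optimal_lattice_pmf K theta01.
pose U n := @translation_mechanism R K f n.
have U_mech n : is_mechanism (U n) by exact: translation_mechanismP.
have U_DP n : is_DP theta (U n) by exact: translation_mechanism_DP.
exists (fun=> lattice K), U; split=> [n|p p0 p1]; first by split.
pose V n := project_hist R (h0 n).
have V_mech n : is_mech_to_hist (V n) by exact: project_histP.
pose W n := cascade (U n) (V n).
have W_HSM n : is_HSM (W n) by exact: cascade_HSM.
have W_DP n : is_DP theta (W n) by exact: cascade_DP.
have star_le n : Dn_star n theta p <= Dn (W n) p.
  apply: ge_inf; last by exists (W n).
  exists 0 => _ [W' [W'_HSM _] <-]; rewrite Dn_multinomial.
  apply: sumr_ge0 => h _; apply: mulr_ge0; first exact: multinomial_pmf_ge0.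
  apply: sumr_ge0 => g _; apply: mulr_ge0; first by have [] := W'_HSM h.
  by rewrite l1dist_l1norm.
have upper eps : 0 < eps -> \forall n \near \oo, Dn (W n) p <= D + eps.
  exact: upper_bound.
have lower eps : 0 < eps -> \forall n \near \oo, D - eps <= Dn_star n theta p.
  by move=> eps0; apply: lower_bound => // n; exists (W n).
(* The chain [D - eps <= Dn_star <= Dn (W n) p <= D + eps], valid for large [n], gives both
   limits. *)
have star_cvg : (fun n => Dn_star n theta p) @ \oo --> D.
  apply/cvgrPdist_le => eps eps0.
  apply: filterS2 (upper _ eps0) (lower _ eps0) => n un ln.
  by rewrite distrC ler_distl ln /=; apply: le_trans un.
have W_cvg : (fun n => Dn (W n) p) @ \oo --> D.
  apply/cvgrPdist_le => eps eps0.
  apply: filterS2 (upper _ eps0) (lower _ eps0) => n un ln.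
  by rewrite distrC ler_distl un andbT; apply: le_trans (star_le n).
(* Convergence of [Dn_star] makes the [limn] in [DK_star] a genuine limit and not a default
   value. *)
exists V; split=> //; split=> //; split; first by apply/cvg_ex; exists D.
by rewrite /DK_star (cvg_lim _ star_cvg).
Qed.
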